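(* Let $H=\alpha(x)(R-I)+\beta(x)(TR-I)$, where the functions $\alpha(x),\beta(x)$ are such that $\beta(-x)+\beta(x-1)=\beta(x)+\beta(-x-1)$. Let $\phi(x)$ be an eigenfunction of $H$, $H[\phi(x)]=\mu\phi(x)$, put $$\chi(x)=\phi(x)-\phi(-x),\qquad \tilde\chi(x)=\beta(-x-1)\phi(x)+\beta(x)\phi(-x-1),$$ assume $\chi$ and $\tilde\chi$ are not identically zero, and let $$\mathcal F_\phi=\frac1{\chi(x)}(R-I)+\frac1{\tilde\chi(x)}(TR+I)\beta(-x-1).$$ Then the Dunkl shift operator of the form $H^{(1)}=\alpha^{(1)}(x)(R-I)+\beta^{(1)}(x)(TR-I)+\gamma^{(1)}(x)$ which satisfies the intertwining relation $\mathcal F_\phi\circ H=H^{(1)}\circ\mathcal F_\phi$ is $$H^{(1)}=\frac{\tilde\chi(-x)}{\chi(x)}(R-I)+\frac{\alpha(-x-1)\beta(x)\chi(-x-1)}{\tilde\chi(x)}(TR-I)+\frac{\tilde\chi(-x)-\tilde\chi(x)}{\chi(x)}.$$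
   Context: The operators act on functions of $x$ by $R[f(x)]=f(-x)$, $T[f(x)]=f(x+1)$, $I[f(x)]=f(x)$; they act only on $x$, so $TR[f(x)]=f(-x-1)$. A function standing to the left or to the right of an operator denotes multiplication by that function, and products of operators are compositions; e.g. $(TR+I)\beta(-x-1)$ maps $f(x)$ to $\beta(x)f(-x-1)+\beta(-x-1)f(x)$. Functions are taken in a field of functions of $x$ containing the rational functions and closed under $x\mapsto -x$, $x\mapsto x+1$ (for example meromorphic functions), so quotients by functions that are not identically zero make sense, and operator identities mean equality of the coefficients of the distinct operators $RTR,T,TR,R,I$. *)

(* Defs.v *)
From mathcomp Require Import all_boot all_order all_algebra.
From mathcomp Require Import ring.

Set Implicit Arguments.
Unset Strict Implicit.
Unset Printing Implicit Defensive.

Import Order.TTheory GRing.Theory Num.Theory.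
Local Open Scope ring_scope.

(* A field of functions of x over a field C of constants.  It contains the
   rational functions, and is stable under the substitutions x |-> -x (fsR)
   and x |-> x + 1 (fsT); these are field morphisms that act on rational
   functions in the expected way.  Since substituting -x, x + 1, -x, x + 1
   successively gives back x, fsRTRT is the defining relation of the group
   generated by the two substitutions.  "Not identically zero" is "!= 0".
   Examples: {fraction {poly C}}, meromorphic functions on the complex plane. *)
Record functionField (C : numFieldType) := FunctionField {
  fsort :> fieldType;
  fsrat : {rmorphism {fraction {poly C}} -> fsort};
  fsR : {rmorphism fsort -> fsort};
  fsT : {rmorphism fsort -> fsort};
  fsR_rat : forall p : {poly C},
    fsR (fsrat (FracField.tofrac p)) = fsrat (FracField.tofrac (p \Po (- 'X)));
  fsT_rat : forall p : {poly C},
    fsT (fsrat (FracField.tofrac p)) = fsrat (FracField.tofrac (p \Po ('X + 1)));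
  fsRR : forall f, fsR (fsR f) = f;
  fsRTRT : forall f, fsR (fsT (fsR (fsT f))) = f
}.

Section Operators.
Variables (C : numFieldType) (K : functionField C).

Definition fscst (c : C) : K := fsrat K (FracField.tofrac c%:P).

Definition opI : K -> K := fun f => f.
Definition opR : K -> K := fun f => fsR K f.
Definition opT : K -> K := fun f => fsT K f.
(* f(x) |-> f(-x-1) *)
Definition opTR : K -> K := opT \o opR.
(* f(x) |-> f(x-1) *)
Definition opRTR : K -> K := opR \o opT \o opR.

Definition mulop (a : K) : K -> K := fun f => a * f.

Definition dunkl (a b : K) : K -> K :=
  (mulop a \o (opR \- opI)) \+ (mulop b \o (opTR \- opI)).

Definition dunkl_pot (a b c : K) : K -> K := dunkl a b \+ mulop c.

Definition chi (phi : K) : K := phi - opR phi.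

Definition chit (beta phi : K) : K := opTR beta * phi + beta * opTR phi.

Definition darboux (beta phi : K) : K -> K :=
  (mulop (chi phi)^-1 \o (opR \- opI)) \+
  (mulop (chit beta phi)^-1 \o ((opTR \+ opI) \o mulop (opTR beta))).

(* Equality of operators below is pointwise equality of maps K -> K.  By
   op_combP this amounts to equality of the coefficients of RTR, T, TR, R, I. *)
Definition op_comb (a b c d e : K) : K -> K :=
  (mulop a \o opRTR) \+ (mulop b \o opT) \+ (mulop c \o opTR) \+
  (mulop d \o opR) \+ (mulop e \o opI).

Lemma vdm5 (F : fieldType) (p q r s t a b c d e : F) :
  (forall k, a * p ^+ k + b * q ^+ k + c * r ^+ k + d * s ^+ k + e * t ^+ k
             = 0) ->
  p - q != 0 -> p - r != 0 -> p - s != 0 -> p - t != 0 -> a = 0.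
Proof.
move=> mom pq pr ps pt; apply/eqP.
suff : a * ((p - q) * (p - r) * (p - s) * (p - t)) == 0.
  by rewrite !mulf_eq0 (negPf pq) (negPf pr) (negPf ps) (negPf pt) !orbF.
pose M k := a * p ^+ k + b * q ^+ k + c * r ^+ k + d * s ^+ k + e * t ^+ k.
have -> : a * ((p - q) * (p - r) * (p - s) * (p - t)) =
  M 4 - (q + r + s + t) * M 3
  + (q * r + q * s + q * t + r * s + r * t + s * t) * M 2
  - (q * r * s + q * r * t + q * s * t + r * s * t) * M 1 + q * r * s * t * M 0.
  by rewrite /M; ring.
by rewrite /M !mom !mulr0 !subr0 !addr0.
Qed.

Lemma op_combP (a b c d e a' b' c' d' e' : K) :
  op_comb a b c d e =1 op_comb a' b' c' d' e' <->
  [/\ a = a', b = b', c = c', d = d' & e = e'].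
Proof.
split=> [eq_ab|[-> -> -> -> ->] f //].
have fsint (m : int) : m%:~R = fsrat K (FracField.tofrac (m%:~R%:P)) :> K.
  by rewrite !rmorph_int.
pose X : K := fsrat K (FracField.tofrac 'X).
have X_neq0 (m n : int) : (m != 0) || (n != 0) -> m%:~R * X + n%:~R != 0.
  move=> mn; rewrite /X !fsint -rmorphM -rmorphD -rmorphM -rmorphD fmorph_eq0.
  rewrite tofrac_eq0; apply/eqP => /polyP z; move: (z 0) (z 1) mn.
  rewrite !coefD !coefCM !coefX !coefC /= mulr0 add0r mulr1 addr0.
  by move=> /eqP + /eqP; rewrite !intr_eq0 => -> ->.
have RX : fsR K X = - X by rewrite /X fsR_rat comp_polyX !rmorphN.
have TX : fsT K X = X + 1 by rewrite /X fsT_rat comp_polyX !rmorphD !rmorph1.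
have TRX : fsT K (fsR K X) = - X - 1 by rewrite RX rmorphN TX opprD.
have RTRX : fsR K (fsT K (fsR K X)) = X - 1.
  by rewrite TRX rmorphB rmorphN rmorph1 RX opprK.
have mom k : (a - a') * (X - 1) ^+ k + (b - b') * (X + 1) ^+ k
    + (c - c') * (- X - 1) ^+ k + (d - d') * (- X) ^+ k + (e - e') * X ^+ k = 0.
  have /eqP := eq_ab (X ^+ k); rewrite -subr_eq0 => /eqP <-.
  rewrite /op_comb /mulop /opTR /opRTR /opI /opT /opR /= !rmorphXn /=.
  by rewrite RTRX TRX RX TX; ring.
have nz (u : K) (m n : int) : u = m%:~R * X + n%:~R ->
    (m != 0) || (n != 0) -> u != 0 by move=> ->; apply: X_neq0.
clear fsint RX TX TRX RTRX X_neq0; clearbody X.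
split; apply/eqP; rewrite -subr_eq0; apply/eqP.
- apply: (@vdm5 _ (X - 1) (X + 1) (- X - 1) (- X) X
    (a - a') (b - b') (c - c') (d - d') (e - e')) => [k||||].
  + exact: mom k.
  + by apply: (nz _ 0 (-2)) => //; ring.
  + by apply: (nz _ 2 0) => //; ring.
  + by apply: (nz _ 2 (-1)) => //; ring.
  + by apply: (nz _ 0 (-1)) => //; ring.
- apply: (@vdm5 _ (X + 1) (X - 1) (- X - 1) (- X) X
    (b - b') (a - a') (c - c') (d - d') (e - e')) => [k||||].
  + by rewrite -[RHS](mom k); ring.
  + by apply: (nz _ 0 2) => //; ring.
  + by apply: (nz _ 2 2) => //; ring.
  + by apply: (nz _ 2 1) => //; ring.
  + by apply: (nz _ 0 1) => //; ring.
- apply: (@vdm5 _ (- X - 1) (X - 1) (X + 1) (- X) X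
    (c - c') (a - a') (b - b') (d - d') (e - e')) => [k||||].
  + by rewrite -[RHS](mom k); ring.
  + by apply: (nz _ (-2) 0) => //; ring.
  + by apply: (nz _ (-2) (-2)) => //; ring.
  + by apply: (nz _ 0 (-1)) => //; ring.
  + by apply: (nz _ (-2) (-1)) => //; ring.
- apply: (@vdm5 _ (- X) (X - 1) (X + 1) (- X - 1) X
    (d - d') (a - a') (b - b') (c - c') (e - e')) => [k||||].
  + by rewrite -[RHS](mom k); ring.
  + by apply: (nz _ (-2) 1) => //; ring.
  + by apply: (nz _ (-2) (-1)) => //; ring.
  + by apply: (nz _ 0 1) => //; ring.
  + by apply: (nz _ (-2) 0) => //; ring.
- apply: (@vdm5 _ X (X - 1) (X + 1) (- X - 1) (- X)
    (e - e') (a - a') (b - b') (c - c') (d - d')) => [k||||].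
  + by rewrite -[RHS](mom k); ring.
  + by apply: (nz _ 0 1) => //; ring.
  + by apply: (nz _ 0 (-1)) => //; ring.
  + by apply: (nz _ 2 1) => //; ring.
  + by apply: (nz _ 2 0) => //; ring.
Qed.

End Operators.

(* Main.v *)
Require Import Defs.
From mathcomp Require Import all_boot all_order all_algebra.
From HB Require Import structures.
From mathcomp Require Import ring.

Set Implicit Arguments.
Unset Strict Implicit.
Unset Printing Implicit Defensive.

Import Order.TTheory GRing.Theory Num.Theory.
Local Open Scope ring_scope.

(** Write R for f(x) |-> f(-x), S = TR for f(x) |-> f(-x-1), c for chi phi and
    t for chit beta phi.  Both R and S are involutive field automorphisms, with
    R S = RTR and S R = T, so either side of the intertwining relation expands
    into a combination of RTR, T, S, R and I ([darboux_dunklE],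
    [dunkl_pot_darbouxE]); such combinations agree exactly when their five
    coefficients do.  The expansions rely on R c = - c and S t = t.

    The coefficients of RTR, T and S are triangular in alpha1, beta1, gamma1
    and determine them; here t != 0 forces beta != 0, so that one can divide by
    beta and by R beta.  It remains to see that the coefficients of R and I then
    agree as well.  Put sigma = beta + S beta.  It is S-invariant by
    construction, and R-invariant by the hypothesis on beta, which makes these
    last two conditions opposite to each other.  The eigenvalue equation reads
    alpha * c = t - (sigma + mu) * phi ([dunkl_eigenE]).  Subtracting from it
    its image under R gives
      (alpha + R alpha + sigma + mu) * c = t - R t       ([dunkl_eigenR]),
    while adding S beta times the equation to beta times its image under S gives
      alpha * c * S beta + S alpha * S c * beta = - mu * t ([dunkl_eigenTR]).
    The last coefficient condition is a combination of these two identities. *)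

Section Intertwining.
Variables (C : numFieldType) (K : functionField C).
Implicit Types (alpha beta phi f : K) (mu : C).

HB.instance Definition _ := GRing.RMorphism.copy (@opR C K) (fsR K).
HB.instance Definition _ := GRing.RMorphism.copy (@opTR C K) (fsT K \o fsR K).

Lemma opRK f : opR (opR f) = f.
Proof. exact: fsRR. Qed.

Lemma opTRK f : opTR (opTR f) = f.
Proof. by apply: (fmorph_inj (fsR K)); rewrite [LHS]fsRTRT. Qed.

Lemma opTR_opR f : opTR (opR f) = opT f.
Proof. by rewrite /opTR /= opRK. Qed.

Lemma opR_cst mu : opR (fscst K mu) = fscst K mu.
Proof. by rewrite /opR fsR_rat comp_polyC. Qed.

Lemma opTR_cst mu : opTR (fscst K mu) = fscst K mu.
Proof. by rewrite /opTR /= opR_cst /opT fsT_rat comp_polyC. Qed.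

Lemma opR_chi phi : opR (chi phi) = - chi phi.
Proof. by rewrite /chi rmorphB /= opRK opprB. Qed.

Lemma opTR_chit beta phi : opTR (chit beta phi) = chit beta phi.
Proof. by rewrite /chit rmorphD /= !rmorphM /= !opTRK addrC. Qed.

Lemma darboux_dunklE alpha beta phi :
  darboux beta phi \o dunkl alpha beta =1
  op_comb (opR beta / chi phi)
    (beta * opTR alpha / chit beta phi)
    (- (beta / chi phi) - beta * opTR alpha / chit beta phi)
    (alpha * opTR beta / chit beta phi
     - (alpha + opR alpha + opR beta) / chi phi)
    ((alpha + opR alpha + beta) / chi phi
     - alpha * opTR beta / chit beta phi).
Proof.
move=> f; rewrite /darboux /dunkl /op_comb /mulop /opI /=.
rewrite !(rmorphD, rmorphN, rmorphM) /= !opTRK !opRK opTR_opR.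
rewrite -[opRTR f]/(opR (opTR f)).
by ring.
Qed.

Lemma dunkl_pot_darbouxE beta phi (alpha1 beta1 gamma1 : K) :
  dunkl_pot alpha1 beta1 gamma1 \o darboux beta phi =1
  op_comb (alpha1 * opR beta / opR (chit beta phi))
    (beta1 / opTR (chi phi))
    ((gamma1 - alpha1) * beta / chit beta phi - beta1 / opTR (chi phi))
    (alpha1 * opRTR beta / opR (chit beta phi) + (gamma1 - beta1) / chi phi)
    ((gamma1 - alpha1) * opTR beta / chit beta phi
     + (beta1 - gamma1) / chi phi).
Proof.
move=> f; rewrite /dunkl_pot /darboux /dunkl /op_comb /mulop /opI /=.
(* Keeps chi and chit atomic while the automorphisms are pushed inwards. *)
move: (chi phi) (chit beta phi) (opR_chi phi) (opTR_chit beta phi) => c t cR tS.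
rewrite !(rmorphD, rmorphN, rmorphM, fmorphV) /= !opTRK !opRK opTR_opR.
rewrite cR tS invrN -[opRTR f]/(opR (opTR f)).
rewrite -[opRTR beta]/(opR (opTR beta)).
by ring.
Qed.

Section Eigenfunction.
Variables (alpha beta phi : K) (mu : C).
Hypothesis hbeta : opR beta + opRTR beta = beta + opTR beta.
Hypothesis hphi : dunkl alpha beta phi = fscst K mu * phi.

Lemma dunkl_eigenE :
  alpha * chi phi = chit beta phi - (beta + opTR beta + fscst K mu) * phi.
Proof.
rewrite [in RHS]mulrDl -hphi /dunkl /mulop /opI /chi /chit /=.
by ring.
Qed.

Lemma dunkl_eigenR :
  (alpha + opR alpha + beta + opTR beta + fscst K mu) * chi phi
  = chit beta phi - opR (chit beta phi).
Proof.
have cphi : chi phi = phi - opR phi by [].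
move: (opR_chi phi) dunkl_eigenE cphi.
move: (chi phi) (chit beta phi) (fscst K mu) (opR_cst mu) => c t m mR cR eI cphi.
have /(congr1 (@opR C K)) := eI.
rewrite !(rmorphD, rmorphN, rmorphM) /= cR mR.
rewrite -[opR (opTR beta)]/(opRTR beta) hbeta mulrN => /eqP.
rewrite eqr_oppLR => /eqP eR.
rewrite -!addrA mulrDl mulrDl eI eR cphi.
by ring.
Qed.

Lemma dunkl_eigenTR :
  alpha * chi phi * opTR beta + opTR alpha * opTR (chi phi) * beta
  = - (fscst K mu * chit beta phi).
Proof.
have tphi : chit beta phi = opTR beta * phi + beta * opTR phi by [].
rewrite -rmorphM /= dunkl_eigenE.
move: (chit beta phi) (opTR_chit beta phi) tphi => t tS tphi.
move: (fscst K mu) (opTR_cst mu) => m mS.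
rewrite !(rmorphD, rmorphN, rmorphM) /= tS opTRK mS tphi.
by ring.
Qed.

End Eigenfunction.

End Intertwining.

(** The chosen alpha1, beta1, gamma1 solve the coefficient equation of I; the
    two hypotheses are [dunkl_eigenR] and [dunkl_eigenTR], with a, b, c, t for
    alpha, beta, chi, chit and a suffix naming the substitution applied. *)
Lemma intertwining_coefI (F : fieldType) (a aR aS b bS c cS t tR m : F) :
  c != 0 -> t != 0 ->
  (a + aR + b + bS + m) * c = t - tR ->
  a * c * bS + aS * cS * b = - (m * t) ->
  (a + aR + b) / c - a * bS / t =
  ((tR - t) / c - tR / c) * bS / t + (aS * b * cS / t - (tR - t) / c) / c.
Proof.
move=> c0 t0 eR eS; have -> : tR = t - (a + aR + b + bS + m) * c.
  by rewrite eR; ring.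
have -> : aS * b * cS = - (m * t) - a * c * bS by rewrite -eS; ring.
by field; rewrite c0 t0.
Qed.

Theorem proposition2p2 (C : numFieldType) (K : functionField C)
    (alpha beta phi : K) (mu : C)
    (hbeta : opR beta + opRTR beta = beta + opTR beta)
    (hphi : dunkl alpha beta phi = fscst K mu * phi)
    (hchi : chi phi != 0)
    (hchit : chit beta phi != 0) :
  forall alpha1 beta1 gamma1 : K,
    darboux beta phi \o dunkl alpha beta
      =1 dunkl_pot alpha1 beta1 gamma1 \o darboux beta phi
    <->
    [/\ alpha1 = opR (chit beta phi) / chi phi,
        beta1 = opTR alpha * beta * opTR (chi phi) / chit beta phi
      & gamma1 = (opR (chit beta phi) - chit beta phi) / chi phi].
Proof.
move=> alpha1 beta1 gamma1.
have b0 : beta != 0.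
  apply: contra_neq hchit => ->.
  by rewrite /chit rmorph0 !mul0r addr0.
have bR0 : opR beta != 0 by rewrite fmorph_eq0.
have tR0 : opR (chit beta phi) != 0 by rewrite fmorph_eq0.
have cS0 : opTR (chi phi) != 0 by rewrite fmorph_eq0.
have eR := dunkl_eigenR hbeta hphi; have eS := dunkl_eigenTR hphi.
split=> [eqFH | [-> -> ->] f].
  have /op_combP[e1 e2 e3 _ _] :
    op_comb _ _ _ _ _ =1 op_comb _ _ _ _ _ :=
    fun f => etrans (esym (darboux_dunklE alpha beta phi f))
      (etrans (eqFH f) (dunkl_pot_darbouxE beta phi alpha1 beta1 gamma1 f)).
  have a1E : alpha1 = opR (chit beta phi) / chi phi.
    apply: (mulIf bR0); apply: (mulIf (invr_neq0 tR0)); rewrite -e1.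
    by field; rewrite hchi tR0.
  split=> //.
    by apply: (mulIf (invr_neq0 cS0)); rewrite -e2; field; rewrite hchit cS0.
  have e4 : (gamma1 - alpha1) * beta / chit beta phi = - (beta / chi phi).
    by move: e3; rewrite e2 => /addIr.
  have -> : gamma1 = alpha1 - chit beta phi / chi phi.
    apply/eqP; rewrite -subr_eq0 opprB addrCA; apply/eqP.
    apply: (mulIf b0); apply: (mulIf (invr_neq0 hchit)).
    rewrite mulrDl mulrDl [_ * _ / _ + _]addrC e4.
    by field; rewrite hchi hchit.
  by rewrite a1E; ring.
rewrite darboux_dunklE dunkl_pot_darbouxE.
have eI := intertwining_coefI hchi hchit eR eS.
congr (op_comb _ _ _ _ _ f).
- by field; rewrite hchi tR0.
- by field; rewrite hchit cS0.
- by field; rewrite hchi hchit cS0.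
- (* By hbeta, the coefficients of R and I add up to the same sum on both
     sides, which reduces this equation to the one for I. *)
  have -> : opR beta = beta + opTR beta - opRTR beta by rewrite -hbeta addrK.
  transitivity ((opRTR beta - opTR beta) / chi phi
    - ((alpha + opR alpha + beta) / chi phi
       - alpha * opTR beta / chit beta phi)); first by ring.
  by rewrite eI; field; rewrite hchi hchit tR0.
- exact: eI.
Qed.
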